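(* Let $\mathcal{N}$ be a finite nonempty set, let $(\mathcal{N}_n)_{n\in\mathcal{N}}$ be pairwise disjoint finite nonempty sets, and let $\lambda_n\in(0,1]$ for each $n\in\mathcal{N}$. Let $\mathcal{J}=\bigcup_{n\in\mathcal{N}}\mathcal{N}_n$, and let $(\varepsilon_j)_{j\in\mathcal{J}}$ be a real random vector with cumulative distribution function $$\Pr(\varepsilon_j\le a_j\ \forall j\in\mathcal{J})=\exp\left(-\sum_{n\in\mathcal{N}}\left(\sum_{j\in\mathcal{N}_n}e^{-a_j/\lambda_n}\right)^{\lambda_n}\right),\qquad (a_j)_{j\in\mathcal{J}}\in\mathbb{R}^{\mathcal{J}}.$$ Then the random vector $(\varepsilon_j)_{j\in\mathcal{J}}$ can be represented (i.e. has the same joint distribution as the vector given) by $$\varepsilon_j=\lambda_n(\epsilon_j+\log Z_n),\qquad j\in\mathcal{N}_n,\ n\in\mathcal{N},$$ where $\epsilon_j\sim\mathcal{G}(0,1)$ for $j\in\mathcal{J}$ and $Z_n\sim\mathcal{P}(\lambda_n)$ for $n\in\mathcal{N}$ are all independent. In particular, for $j\in\mathcal{N}_n$ and $j'\in\mathcal{N}_{n'}$ with $j\ne j'$, the correlation between $\varepsilon_j$ and $\varepsilon_{j'}$ equals $1-\lambda_n^2$ if $n=n'$, and $0$ otherwise.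
   Context: ''$\sim$'' means ''is distributed as''. $\mathcal{G}(0,1)$ denotes the standard Gumbel distribution, with cumulative distribution function $z\mapsto\exp(-\exp(-z))$. For $0<\lambda\le 1$, $\mathcal{P}(\lambda)$ denotes the positive stable distribution with parameter $\lambda$: the probability distribution on $\mathbb{R}_+$ whose Laplace transform is $\mathbb{E}_{Z\sim\mathcal{P}(\lambda)}[\exp(-tZ)]=\exp(-t^{\lambda})$ for all $t\ge 0$ (its existence is a known fact). A variable with law $\mathcal{P}(\lambda)$ is almost surely strictly positive, so its logarithm is almost surely well defined. The elements of $\mathcal{N}$ index nests, $\mathcal{N}_n$ is the set of alternatives in nest $n$, and the displayed distribution of $(\varepsilon_j)$ is the nested logit distribution. ''Correlation'' is the Pearson correlation coefficient. *)

(* Defs.v *)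
From HB Require Import structures.
From mathcomp Require Import all_boot all_order all_algebra.
From mathcomp Require Import all_classical all_reals all_analysis.

Set Implicit Arguments.
Unset Strict Implicit.
Unset Printing Implicit Defensive.

Import Order.TTheory GRing.Theory Num.Theory.
Import numFieldNormedType.Exports.

Local Open Scope classical_set_scope.
Local Open Scope ring_scope.

Definition standard_gumbel (R : realType) (mu : probability R R) : Prop :=
  forall z : R, mu `]-oo, z]%classic = (expR (- expR (- z)))%:E.

(* The law is carried by [0, +oo[ and is given by its Laplace transform, which
   determines it uniquely. *)
Definition positive_stable (R : realType) (l : R) (mu : probability R R) : Prop :=
  mu `]-oo, 0[%classic = 0%E /\
  forall t : R, 0 <= t ->
    (\int[mu]_z (expR (- (t * z)))%:E = (expR (- (t `^ l)))%:E)%E.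

Definition mutually_independent (R : realType) (d : measure_display)
    (T : measurableType d) (P : probability T R) (I : finType)
    (X : I -> {RV P >-> R}) : Prop :=
  forall (K : {set I}) (B : I -> set R), (forall i, measurable (B i)) ->
    P [set w | forall i, i \in K -> B i (X i w)] =
    (\prod_(i in K) P (X i @^-1` B i))%E.

(* The product (= Borel) sigma-algebra of R^J, generated by the coordinates. *)
Definition product_borel (R : realType) (J : finType) : set (set (J -> R)) :=
  <<s [set C | exists (j : J) (B : set R),
        measurable B /\ C = (fun x : J -> R => x j) @^-1` B] >>.

Definition same_joint_law (R : realType) (J : finType)
    (d : measure_display) (T : measurableType d) (P : probability T R)
    (X : J -> T -> R)
    (d' : measure_display) (T' : measurableType d') (Q : probability T' R)
    (Y : J -> T' -> R) : Prop :=
  forall C : set (J -> R), product_borel C ->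
    P [set w | C (X ^~ w)] = Q [set w | C (Y ^~ w)].

(* [ln z = 0] for [z <= 0], but [Z n] is almost surely positive, so this
   convention only matters on a null set. *)
Definition nested_logit_representation (R : realType) (N J : finType)
    (nest : N -> {set J}) (lam : N -> R)
    (d : measure_display) (T : measurableType d) (Q : probability T R)
    (g : J -> {RV Q >-> R}) (Z : N -> {RV Q >-> R}) (Y : J -> T -> R) : Prop :=
  [/\ forall j, standard_gumbel (distribution Q (g j)),
      forall n, positive_stable (lam n) (distribution Q (Z n)),
      mutually_independent
        (fun i : J + N => match i with inl j => g j | inr n => Z n end) &
      forall n j, j \in nest n ->
        forall w, Y j w = lam n * (g j w + ln (Z n w))].

(* Only meaningful for square-integrable [X] and [Y] of nonzero variance. *)
Definition correlation (R : realType) (d : measure_display)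
    (T : measurableType d) (P : probability T R) (X Y : T -> R) : R :=
  fine (covariance P X Y) /
  (Num.sqrt (fine (variance P X)) * Num.sqrt (fine (variance P Y))).

(* Main.v *)
Require Import Defs.
From HB Require Import structures.
From mathcomp Require Import all_boot all_order all_algebra.
From mathcomp Require Import all_classical all_reals all_analysis.
From mathcomp Require Import measurable_realfun.
From mathcomp Require Import ring lra.

Import Order.TTheory GRing.Theory Num.Theory.
Import numFieldNormedType.Exports.

Local Open Scope classical_set_scope.
Local Open Scope ring_scope.

(** Conditionally on the variables [Z n], the events [Y j <= a j] are
  independent, and the Gumbel distribution function turns the shift by [ln Z]
  into an exponential of [Z]:
  [exp (- exp (- (c - ln z))) = exp (- z * exp (- c))]. The conditional
  probability that [Y j <= a j] for all [j] is therefore a product over the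
  nests of [exp (- s n * Z n)], where [s n] is the sum of
  [exp (- a j / lam n)] over the nest; its expectation is a product of Laplace
  transforms of positive stable laws, which is the nested logit distribution
  function ([nested_logit_cdf]). Since orthants form a pi-system generating the
  product sigma-algebra, this distribution function determines the joint law
  ([same_cdf_same_joint_law]).

  Conditioning on [Z] needs the law of the whole family to be a product
  measure. Mutual independence being a property of the joint law, it is enough
  to compute on one convenient sample space: a product of a space carrying the
  Gumbel variables with one carrying the stable variables
  ([exists_independent], [product_family_event]), where Tonelli applies.

  The correlations need no explicit moment. The marginals of the nested logit
  law are again standard Gumbel ([nested_logit_gumbel]), so that [Y j] and [g j]
  have the same variance [v], which is finite and positive ([gumbel_Lfun2],
  [gumbel_variance_gt0]). Independence in [Y j = lam n * (g j + ln (Z n))] gives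
  [v = lam n ^ 2 * (v + Var (ln (Z n)))], while for two alternatives of the same
  nest only [ln (Z n)] is shared, so that their covariance is
  [lam n ^ 2 * Var (ln (Z n)) = v * (1 - lam n ^ 2)]. Across nests nothing is
  shared and the covariance vanishes. *)

(** * Joint laws are determined by joint distribution functions *)

Section joint_law.
Context {R : realType} {J : finType}.

(** The family generating [product_borel], named so that [RJ] below is a
  measurable type whose measurable sets are those of [product_borel]. *)
Definition coordinate_cylinders : set (set (J -> R)) :=
  [set C | exists (j : J) (B : set R),
     measurable B /\ C = (fun x : J -> R => x j) @^-1` B].

Notation RJ := (g_sigma_algebraType coordinate_cylinders).

Definition orthants : set (set (J -> R)) :=
  range (fun (a x : J -> R) => forall j, x j <= a j).

Lemma measurable_coordinate (j : J) :
  measurable_fun [set: RJ] ((fun x => x j) : RJ -> R).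
Proof.
by move=> _ B mB; rewrite setTI; apply: sub_sigma_algebra; exists j, B.
Qed.

Lemma measurable_to_function_space {d} {T : measurableType d}
    (X : J -> T -> R) :
  (forall j, measurable_fun [set: T] (X j)) ->
  measurable_fun [set: T] ((fun w j => X j w) : T -> RJ).
Proof.
move=> mX; apply: (@measurability _ _ _ RJ _ _ coordinate_cylinders) => //.
move=> _ [_ [j [B [mB ->]]] <-]; exact: mX.
Qed.

Lemma orthants_setI : setI_closed orthants.
Proof.
move=> _ _ [a _ <-] [b _ <-]; exists (fun j => Num.min (a j) (b j)) => //.
apply/seteqP; split => x /=.
  by move=> xab; split => j; move: (xab j); rewrite le_min => /andP[].
by move=> [xa xb] j; rewrite le_min xa xb.
Qed.

Lemma orthants_cover :
  \bigcup_k [set x : J -> R | forall j, x j <= k%:R] = setT.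
Proof.
apply/seteqP; split => // x _.
pose M := \sum_j `|x j|.
have [k Mk] : exists k : nat, M <= k%:R.
  by exists (Num.truncn M).+1; rewrite ltW// truncnS_gt.
exists k => // j; rewrite (le_trans _ Mk)// (le_trans (ler_norm _))//.
by rewrite /M (bigD1 j)//= lerDl sumr_ge0.
Qed.

(** A half-space [x j <= b] is the increasing union of the orthants that bound
  the other coordinates by [k], so orthants already generate all coordinates. *)
Lemma product_borelE : @product_borel R J = <<s orthants >>.
Proof.
apply/seteqP; split; last first.
  apply: smallest_sub; first exact: smallest_sigma_algebra.
  move=> _ [a _ <-].
  rewrite (_ : (fun _ => _) =
      \bigcap_(j in [set: J]) ((fun x : J -> R => x j) @^-1` `]-oo, a j])).
    apply: (@fin_bigcap_measurable _ RJ) => // j _.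
    rewrite -[X in measurable X]setTI; exact: measurable_coordinate.
  apply/seteqP; split => x /= xa j; first by move=> _; rewrite /= in_itv/=.
  by have := xa j I; rewrite /= in_itv.
pose RO := g_sigma_algebraType orthants.
have mray (j : J) (b : R) : <<s orthants >> [set x : J -> R | x j <= b].
  rewrite (_ : [set x | _] = \bigcup_k
      [set x : J -> R | forall i, x i <= if i == j then b else k%:R]).
    apply: (@bigcupT_measurable _ RO) => k; apply: sub_sigma_algebra.
    by exists (fun i => if i == j then b else k%:R).
  apply/seteqP; split => x /=; last by move=> [k _ /(_ j)]; rewrite eqxx.
  move=> xb; have : setT x by [].
  rewrite -orthants_cover => -[k _ xk]; exists k => // i /=.
  by case: eqP => [->|_].
apply: smallest_sub; first exact: smallest_sigma_algebra.
move=> _ [j [B [mB ->]]].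
have mj : measurable_fun [set: RO] ((fun x => x j) : RO -> R).
  apply: (measurability _ (RGenOInfty.measurableE R)) => // _ [_ [b ->] <-].
  rewrite setTI (_ : _ @^-1` _ = ~` [set x : J -> R | x j <= b]).
    by apply: (@measurableC _ RO); exact: mray.
  by apply/seteqP; split => x /=; rewrite in_itv/= andbT ltNge => /negP.
by have := mj measurableT B mB; rewrite setTI.
Qed.

(** Uniqueness of measures on a pi-system: orthants are stable under
  intersection, generate the product sigma-algebra and exhaust the space. *)
Lemma same_cdf_same_joint_law {d} {T : measurableType d}
    (P : probability T R) {d'} {T' : measurableType d'}
    (Q : probability T' R) (X : J -> T -> R) (Y : J -> T' -> R) :
  (forall j, measurable_fun [set: T] (X j)) ->
  (forall j, measurable_fun [set: T'] (Y j)) ->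
  (forall a : J -> R, P [set w | forall j, X j w <= a j] =
                      Q [set w | forall j, Y j w <= a j]) ->
  same_joint_law P X Q Y.
Proof.
move=> mX mY XY C mC.
have mX' := measurable_to_function_space X mX.
have mY' := measurable_to_function_space Y mY.
pose X' := mfun_Sub (mem_set mX').
pose Y' := mfun_Sub (mem_set mY').
apply: (@measure_unique _ R RJ orthants
  (fun k => [set x : J -> R | forall j, x j <= k%:R]) _ _ _ _
  (distribution P X') (distribution Q Y')) => //.
- exact: product_borelE.
- exact: orthants_setI.
- by move=> k; exists (fun=> k%:R).
- exact: orthants_cover.
- by move=> _ [a _ <-]; exact: XY.
- move=> k; apply: (le_lt_trans (probability_le1 _ _)); last exact: ltry.
  suff : @product_borel R J [set x | forall j, x j <= k%:R] by [].
  by rewrite product_borelE; apply: sub_sigma_algebra; exists (fun=> k%:R).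
Qed.

End joint_law.
Arguments coordinate_cylinders : clear implicits.

(** * Equality of laws and integrals *)

Section equal_laws.
Context {R : realType} {d d' d2 : measure_display}
  {T : measurableType d} {T' : measurableType d'} {S : measurableType d2}
  {P : probability T R} {Q : probability T' R} {X : T -> S} {Y : T' -> S}.
Hypotheses (mX : measurable_fun [set: T] X) (mY : measurable_fun [set: T'] Y).
Hypothesis XY : forall A, measurable A -> P (X @^-1` A) = Q (Y @^-1` A).
Local Open Scope ereal_scope.

(** Both sides are the integral of [f] against the common law. The positive and
  negative parts are transported separately, which covers every measurable [f]. *)
Lemma eq_law_integral (f : S -> \bar R) :
  measurable_fun [set: S] f -> \int[P]_w f (X w) = \int[Q]_w f (Y w).
Proof.
move=> mf.
have ge0_case (g : S -> \bar R) : measurable_fun [set: S] g ->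
    (forall x, 0 <= g x) -> \int[P]_w g (X w) = \int[Q]_w g (Y w).
  move=> mg g0; pose X' := mfun_Sub (mem_set mX); pose Y' := mfun_Sub (mem_set mY).
  have /= <- := @ge0_integral_distribution _ _ _ _ _ P X' g mg g0.
  have /= <- := @ge0_integral_distribution _ _ _ _ _ Q Y' g mg g0.
  by apply: eq_measure_integral => A mA _; exact: XY.
rewrite integralE [RHS]integralE; congr (_ - _).
- under eq_integral do rewrite (funepos_comp f X).
  under [RHS]eq_integral do rewrite (funepos_comp f Y).
  by apply: ge0_case => //; exact: measurable_funepos.
- under eq_integral do rewrite (funeneg_comp f X).
  under [RHS]eq_integral do rewrite (funeneg_comp f Y).
  by apply: ge0_case => //; exact: measurable_funeneg.
Qed.

Lemma eq_law_expectation (f : S -> R) : measurable_fun [set: S] f ->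
  'E_P[f \o X] = 'E_Q[f \o Y].
Proof.
move=> mf; rewrite unlock; apply: (eq_law_integral (EFin \o f)).
exact: measurableT_comp.
Qed.

Lemma eq_law_covariance (f g : S -> R) :
  measurable_fun [set: S] f -> measurable_fun [set: S] g ->
  covariance P (f \o X) (g \o X) = covariance Q (f \o Y) (g \o Y).
Proof.
move=> mf mg; rewrite unlock !eq_law_expectation//.
pose h x := ((f x - fine 'E_Q[f \o Y]) * (g x - fine 'E_Q[g \o Y]))%R.
apply: (eq_law_expectation h).
by apply: measurable_funM; apply: measurable_funB.
Qed.

Lemma eq_law_variance (f : S -> R) : measurable_fun [set: S] f ->
  variance P (f \o X) = variance Q (f \o Y).
Proof. by move=> mf; exact: eq_law_covariance. Qed.

End equal_laws.

(** * Independent families with prescribed marginals *)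

(** Mutual independence with marginals [mu], stated for expectations of products
  instead of probabilities of boxes: this form passes through iterated products
  of spaces and can be used directly under an integral. *)
Definition independent_with_laws {R : realType} {I : finType}
    (mu : I -> probability R R) {d} {T : measurableType d}
    (Q : probability T R) (X : I -> {RV Q >-> R}) : Prop :=
  forall f : I -> R -> R, (forall i, measurable_fun [set: R] (f i)) ->
    (forall i x, 0 <= f i x) ->
    (\int[Q]_w (\prod_i f i (X i w))%:E =
     \prod_i \int[mu i]_x (f i x)%:E)%E.

(** The sample space is a finite product of copies of the real line, adjoined one
  factor at a time; Tonelli's theorem carries the product rule along. *)
Lemma exists_independent {R : realType} {I : finType}
    (mu : I -> probability R R) :
  exists (d : measure_display) (T : measurableType d) (Q : probability T R)
         (X : I -> {RV Q >-> R}), independent_with_laws mu Q X.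
Proof.
suff [d [T [Q [X HX]]]] : exists (d : measure_display) (T : measurableType d)
    (Q : probability T R) (X : I -> {RV Q >-> R}),
    forall f : I -> R -> R, (forall i, measurable_fun [set: R] (f i)) ->
      (forall i x, 0 <= f i x) ->
      (\int[Q]_w (\prod_(i <- enum I) f i (X i w))%:E =
       \prod_(i <- enum I) \int[mu i]_x (f i x)%:E)%E.
  exists d, T, Q, X => f mf f0; rewrite -big_enum -HX//.
  by under eq_integral do rewrite -big_enum.
elim: (enum I) (enum_uniq I) => [|i s IH /= /andP[iNs us]].
  move=> _; exists _, _, (@dirac _ unit tt R), (fun=> cst 0) => f mf f0.
  by under eq_integral do rewrite big_nil; rewrite big_nil integral_cst//= diracT mule1.
have [d [T [Q [X HX]]]] := IH us.
have mX k : measurable_fun [set: T * R] (if k == i then snd else X k \o fst).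
  by case: ifPn => _; [exact: measurable_snd | exact: measurableT_comp].
exists _, _, (Q \x mu i)%E, (fun k => mfun_Sub (mem_set (mX k))) => f mf f0.
rewrite big_cons -HX//.
have mprod : measurable_fun [set: T] (fun w => \prod_(k <- s) f k (X k w)).
  by apply: measurable_prod => k _; apply: measurableT_comp.
have prod_ge0 w : 0 <= \prod_(k <- s) f k (X k w) by apply: prodr_ge0.
transitivity (\int[(Q \x mu i)%E]_w
    (f i w.2 * \prod_(k <- s) f k (X k w.1))%:E)%E.
  apply: eq_integral => w _; rewrite big_cons /= eqxx; congr (_ * _)%:E.
  rewrite big_seq [RHS]big_seq; apply: eq_bigr => k ks.
  by case: eqP => // ki; move: iNs; rewrite -ki ks.
rewrite fubini_tonelli1; last 2 first.
- apply/measurable_EFinP; apply: measurable_funM.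
    exact: measurableT_comp.
  exact: (@measurableT_comp _ _ _ _ _ _ _ _ _ mprod).
- by move=> w /=; rewrite lee_fin mulr_ge0.
rewrite /fubini_F /=.
under eq_integral => w _.
  under eq_integral do rewrite EFinM.
  rewrite ge0_integralZr//; [|exact/measurable_EFinP
    |by move=> x _; rewrite lee_fin|by rewrite lee_fin].
  over.
rewrite ge0_integralZl//.
- exact/measurable_EFinP.
- by move=> w _; rewrite lee_fin.
- by apply: integral_ge0 => x _; rewrite lee_fin.
Qed.

Section independent_with_laws.
Context {R : realType} {I : finType} {mu : I -> probability R R}
  {d : measure_display} {T : measurableType d} {Q : probability T R}
  {X : I -> {RV Q >-> R}}.
Hypothesis Xmu : independent_with_laws mu Q X.

Lemma independent_with_laws_event (K : {set I}) (B : I -> set R) :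
  (forall i, measurable (B i)) ->
  Q [set w | forall i, i \in K -> B i (X i w)] = (\prod_(i in K) mu i (B i))%E.
Proof.
move=> mB.
pose f i : R -> R := if i \in K then \1_(B i) else cst 1.
have mf i : measurable_fun [set: R] (f i).
  by rewrite /f; case: ifPn => _; [exact: measurable_indic | exact: measurable_cst].
have f0 i x : 0 <= f i x by rewrite /f; case: ifPn.
have mE : measurable [set w | forall i, i \in K -> B i (X i w)].
  rewrite (_ : [set _ | _] = \bigcap_(i in [set i | i \in K]) (X i @^-1` B i))//.
  apply: fin_bigcap_measurable => // i _.
  by rewrite -[_ @^-1` _]setTI; exact: measurable_funP.
have := Xmu f mf f0.
have -> : (\prod_i \int[mu i]_x (f i x)%:E = \prod_(i in K) mu i (B i))%E.
  rewrite [RHS]big_mkcond; apply: eq_bigr => i _; rewrite /f.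
  case: ifPn => _; first by rewrite integral_indic// setIT.
  by rewrite /= integral_cst// [X in (_ * X)%E]probability_setT mule1.
move=> <-; rewrite -[X in Q X]setIT -integral_indic//.
apply: eq_integral => w _; congr EFin.
rewrite indicE; have [wE|wE] := boolP (w \in _).
  rewrite big1// => i _; rewrite /f; case: ifPn => // iK.
  by rewrite indicE mem_set//; move/set_mem : wE; exact.
apply/esym/eqP; rewrite prodf_seq_eq0.
move: wE; rewrite notin_setE /= => /existsNP[i /not_implyP[iK nB]].
apply/hasP; exists i; first by rewrite mem_index_enum.
by rewrite /f iK indicE memNset.
Qed.

Lemma independent_with_laws_distribution (i : I) (A : set R) :
  measurable A -> distribution Q (X i) A = mu i A.
Proof.
move=> mA; have := independent_with_laws_event (finset.set1 i) (fun=> A) (fun=> mA).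
rewrite big_set1 => <-; congr (Q _); apply/seteqP; split => w /=.
  by move=> XA k; rewrite finset.inE => /eqP ->.
by apply; rewrite finset.inE.
Qed.

Lemma independent_with_laws_mutually : mutually_independent X.
Proof.
move=> K B mB; rewrite independent_with_laws_event//.
by apply: eq_bigr => i _; rewrite -independent_with_laws_distribution.
Qed.

End independent_with_laws.

Lemma exists_mutually_independent {R : realType} {I : finType}
    (mu : I -> probability R R) :
  exists (d : measure_display) (T : measurableType d) (Q : probability T R)
         (X : I -> {RV Q >-> R}),
    (forall i A, measurable A -> distribution Q (X i) A = mu i A) /\
    mutually_independent X.
Proof.
have [d [T [Q [X HX]]]] := exists_independent mu.
exists d, T, Q, X; split; last exact: independent_with_laws_mutually HX.
by move=> i A mA; exact: (independent_with_laws_distribution HX).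
Qed.

(** * Positive stable laws *)

Section positive_stable.
Context {R : realType}.
Implicit Types (l x : R) (mu : probability R R).

Local Lemma measurable_laplace_kernel (t : R) :
  measurable_fun [set: R] (fun z => expR (- (t * z))).
Proof.
by apply: measurableT_comp => //; apply: measurableT_comp => //; exact: measurable_funM.
Qed.

(** The mass of an atom at [0] is a lower bound of the Laplace transform at every
  [t], and [expR (- (t `^ l))] takes arbitrarily small values. *)
Lemma positive_stable_gt0 l mu : 0 < l -> positive_stable l mu ->
  mu `]-oo, 0]%classic = 0%E.
Proof.
move=> l0 [mu_neg laplace].
have atom_le t : 0 <= t -> (mu [set 0%R] <= (expR (- (t `^ l)))%:E)%E.
  move=> t0; rewrite -laplace// -[X in mu X]setIT -integral_indic//.
  apply: ge0_le_integral => //.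
  - by apply/measurable_EFinP; exact: measurable_indic.
  - by apply/measurable_EFinP; exact: measurable_laplace_kernel.
  - move=> z _; rewrite lee_fin indicE; case: (boolP (z \in _)) => [|_].
      by rewrite inE => ->; rewrite mulr0 oppr0 expR0.
    exact: expR_ge0.
have -> : `]-oo, 0%R]%classic = `]-oo, 0%R[ `|` [set (0 : R)].
  apply/seteqP; split => x /=; rewrite !in_itv/=.
    by rewrite le_eqVlt => /predU1P[->|->]; [right|left].
  by case=> [/ltW //|->]; rewrite lexx.
rewrite measureU0//.
have [//|atom_gt0] : mu [set 0%R] = 0%E \/ (0 < mu [set 0%R])%E.
  by have := measure_ge0 mu [set 0%R]; rewrite le_eqVlt => /predU1P[->|]; [left|right].
exfalso.
have fin := fin_num_measure mu [set 0%R] (measurable_set1 _).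
pose r := fine (mu [set 0%R]).
have r0 : 0 < r by rewrite /r fine_gt0// atom_gt0 ltey_eq fin.
have r1 : r <= 1 by rewrite -lee_fin fineK// probability_le1.
have x0 : 0 <= 1 - ln r by rewrite subr_ge0 (le_trans _ ler01)// ln_le0.
(* at this [t] the bound is [expR (ln r - 1)], that is [r / e] *)
have := atom_le ((1 - ln r) `^ l^-1) (powR_ge0 _ _).
rewrite -powRrM mulVf ?gt_eqF// powRr1// -(fineK fin) lee_fin -/r.
rewrite opprB expRD lnK ?posrE// leNgt => /negP; apply.
by rewrite -[ltRHS]mulr1 ltr_pM2l// expR_lt1 oppr_lt0.
Qed.

(** Max-stability of the Gumbel distribution: a shift by [ln x] becomes a factor
  [x] in the exponent, and a product over alternatives becomes a sum there. *)
Lemma prod_gumbel_cdf {J : finType} (A : pred J) (c : J -> R) x : 0 < x ->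
  \prod_(j | A j) expR (- expR (- (c j - ln x))) =
  expR (- ((\sum_(j | A j) expR (- c j)) * x)).
Proof.
move=> x0; rewrite -expR_sum sumrN mulr_suml; congr (expR (- _)).
by apply: eq_bigr => j _; rewrite opprB addrC expRD lnK.
Qed.

(** The two integrands differ on the null set [x <= 0], where [ln x = 0]. *)
Lemma integral_prod_gumbel_cdf {J : finType} (A : pred J) (c : J -> R) l mu :
  0 < l -> positive_stable l mu ->
  (\int[mu]_x (\prod_(j | A j) expR (- expR (- (c j - ln x))))%:E =
   (expR (- (\sum_(j | A j) expR (- c j)) `^ l))%:E)%E.
Proof.
move=> l0 mus; have [_ laplace] := mus.
rewrite -laplace; last by apply: sumr_ge0 => j _; exact: expR_ge0.
apply: ae_eq_integral => //.
- apply/measurable_EFinP; under eq_fun do rewrite -big_filter.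
  apply: measurable_prod => j _.
  apply: measurableT_comp => //; apply: measurableT_comp => //.
  apply: measurableT_comp => //; apply: measurableT_comp => //.
  by apply: measurable_funB => //; exact: measurable_ln.
- by apply/measurable_EFinP; exact: measurable_laplace_kernel.
- exists `]-oo, 0%R]%classic; split => //; first exact: positive_stable_gt0 mus.
  move=> x /= /not_implyP[_ neq]; rewrite in_itv/= leNgt; apply/negP => x0.
  by apply: neq; rewrite prod_gumbel_cdf.
Qed.

End positive_stable.

(** * Juxtaposition of two independent families *)

Section product_family.
Context {R : realType} {J N : finType}
  {mu : J -> probability R R} {nu : N -> probability R R}
  {d1 d2 : measure_display} {T1 : measurableType d1} {T2 : measurableType d2}
  {Q1 : probability T1 R} {Q2 : probability T2 R}
  {G : J -> {RV Q1 >-> R}} {S : N -> {RV Q2 >-> R}}.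
Hypotheses (Gmu : independent_with_laws mu Q1 G)
  (Snu : independent_with_laws nu Q2 S).

(** The factor carrying [S] comes first because the product measure is defined by
  integrating, over the first factor, the measures of the sections: this is the
  conditioning on [S] used for the nested logit distribution. *)
Definition product_family (i : J + N) : T2 * T1 -> R :=
  match i with inl j => G j \o snd | inr n => S n \o fst end.

Lemma measurable_product_family i :
  measurable_fun [set: T2 * T1] (product_family i).
Proof.
by case: i => [j|n]; apply: measurableT_comp.
Qed.

Lemma product_family_event (K : {set J + N}) (B : J + N -> set R) :
  (forall i, measurable (B i)) ->
  (Q2 \x Q1)%E [set w | forall i, i \in K -> B i (product_family i w)] =
  (\prod_(i in K) match i with inl j => mu j (B i) | inr n => nu n (B i) end)%E.
Proof.
move=> mB.
pose E1 := [set w | forall j, j \in [set j | inl j \in K]%SET -> B (inl j) (G j w)].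
pose E2 := [set w | forall n, n \in [set n | inr n \in K]%SET -> B (inr n) (S n w)].
have mE1 : measurable E1.
  rewrite (_ : E1 =
    \bigcap_(j in [set j | j \in [set j | inl j \in K]%SET]) (G j @^-1` B (inl j)))//.
  apply: fin_bigcap_measurable => // i _.
  by rewrite -[_ @^-1` _]setTI; exact: measurable_funP.
have mE2 : measurable E2.
  rewrite (_ : E2 =
    \bigcap_(n in [set n | n \in [set n | inr n \in K]%SET]) (S n @^-1` B (inr n)))//.
  apply: fin_bigcap_measurable => // i _.
  by rewrite -[_ @^-1` _]setTI; exact: measurable_funP.
transitivity ((Q2 \x Q1)%E (E2 `*` E1)).
  congr (_ _); apply/seteqP; split => -[w2 w1] /=.
    by move=> H; split => k; rewrite finset.inE => /H.
  by move=> [H2 H1] [j|n] iK; [apply: H1|apply: H2]; rewrite finset.inE.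
rewrite product_measure1E// muleC.
have /= -> := independent_with_laws_event Gmu [set j | inl j \in K]%SET
  (fun j => B (inl j)) (fun j => mB (inl j)).
have /= -> := independent_with_laws_event Snu [set n | inr n \in K]%SET
  (fun n => B (inr n)) (fun n => mB (inr n)).
rewrite big_sumType; congr (_ * _)%E;
  by apply: eq_bigl => i; rewrite finset.inE.
Qed.

End product_family.
Arguments product_family {R J N d1 d2 T1 T2 Q1 Q2} G S.

(** * The nested logit distribution function *)

Section nested_logit_cdf.
Context {R : realType} {J N : finType} {nu : J -> N} {lam : N -> R}.
Hypothesis lam_gt0 : forall n, 0 < lam n.
Context {d : measure_display} {T : measurableType d} {Q : probability T R}
  {g : J -> {RV Q >-> R}} {Z : N -> {RV Q >-> R}}.
Hypotheses (gumbel_g : forall j, standard_gumbel (distribution Q (g j)))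
  (stable_Z : forall n, positive_stable (lam n) (distribution Q (Z n)))
  (indep : mutually_independent
     (fun i : J + N => match i with inl j => g j | inr n => Z n end)).

Let shocks (i : J + N) : T -> R := match i with inl j => g j | inr n => Z n end.

Let mshocks i : measurable_fun [set: T] (shocks i).
Proof. by case: i => ?; exact: measurable_funP. Qed.

Let below (K : {set J}) (a : J -> R) : set (J + N -> R) :=
  [set x | forall j, j \in K ->
     lam (nu j) * (x (inl j) + ln (x (inr (nu j)))) <= a j].

Let below_borel K a : @product_borel R (J + N)%type (below K a).
Proof.
pose RI := g_sigma_algebraType (coordinate_cylinders R (J + N)%type).
pose h j (x : RI) : R := lam (nu j) * (x (inl j) + ln (x (inr (nu j)))).
have mh j : measurable_fun [set: RI] (h j).
  apply: measurable_funM => //; apply: measurable_funD.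
    exact: measurable_coordinate.
  by apply: measurableT_comp; [exact: measurable_ln|exact: measurable_coordinate].
rewrite (_ : below K a = \bigcap_(j in [set j | j \in K]) (h j @^-1` `]-oo, a j])).
  apply: (@fin_bigcap_measurable _ RI) => // j _.
  by rewrite -[X in measurable X]setTI; exact: mh.
by apply/seteqP; split => x /= xa j jK; have := xa j jK; rewrite /= in_itv.
Qed.

(** The events are restricted to a set [K] of alternatives so that the marginals
  are covered as well as the full joint distribution. The computation takes place
  on the product of canonical spaces, which carries the same joint law. *)
Lemma nested_logit_cdf (K : {set J}) (a : J -> R) :
  Q [set w | forall j, j \in K ->
       lam (nu j) * (g j w + ln (Z (nu j) w)) <= a j] =
  (expR (- \sum_(n : N)
     (\sum_(j in K | nu j == n) expR (- a j / lam n)) `^ lam n))%:E.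
Proof.
have [d1 [T1 [Q1 [G HG]]]] := exists_independent (fun j => distribution Q (g j)).
have [d2 [T2 [Q2 [S HS]]]] := exists_independent (fun n => distribution Q (Z n)).
have same_law : same_joint_law Q shocks (Q2 \x Q1)%E (product_family G S).
  apply: same_cdf_same_joint_law => [//|i|b].
    exact: measurable_product_family.
  have setTE T' (X : J + N -> T' -> R) : [set w | forall i, X i w <= b i] =
      [set w | forall i, i \in [set: (J + N)%type]%SET -> `]-oo, b i]%classic (X i w)].
    apply/seteqP; split => w /= H i; first by rewrite in_itv => _; exact: H.
    by have := H i (finset.in_setT i); rewrite /= in_itv.
  rewrite !setTE.
  have /= -> := product_family_event HG HS [set: (J + N)%type]%SET
    (fun i => `]-oo, b i]%classic) (fun i => measurable_itv _).
  have /= := indep [set: (J + N)%type]%SET (fun i => `]-oo, b i]%classic).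
  rewrite (_ : [set w | _] = [set w | forall i, i \in [set: (J + N)%type]%SET ->
     `]-oo, b i]%classic (shocks i w)]); last first.
    by apply/seteqP; split => w H [j|n]; exact: H.
  by move=> ->//; apply: eq_bigr => -[j|n].
have -> := same_law (below K a) (below_borel K a).
pose f n x := \prod_(j in K | nu j == n) expR (- expR (- (a j / lam n - ln x))).
have mf n : measurable_fun [set: R] (f n).
  rewrite /f; under eq_fun do rewrite -big_filter.
  apply: measurable_prod => j _.
  apply: measurableT_comp => //; apply: measurableT_comp => //.
  apply: measurableT_comp => //; apply: measurableT_comp => //.
  by apply: measurable_funB => //; exact: measurable_ln.
(* conditioning on the stable variables *)
transitivity (\int[Q2]_z (\prod_n f n (S n z))%:E)%E.
  apply: eq_integral => z _ /=.
  rewrite (_ : xsection _ z = [set w | forall j, j \in K ->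
      `]-oo, a j / lam (nu j) - ln (S (nu j) z)]%classic (G j w)]); last first.
    apply/seteqP; split => w /=; rewrite /xsection /= inE /= => H j jK.
      by have := H j jK; rewrite in_itv/= lerBrDr ler_pdivlMr// mulrC.
    by have := H j jK; rewrite in_itv/= lerBrDr ler_pdivlMr// mulrC.
  have /= -> := independent_with_laws_event HG K
    (fun j => `]-oo, a j / lam (nu j) - ln (S (nu j) z)]%classic)
    (fun j => measurable_itv _).
  rewrite (partition_big nu xpredT)//= -prodEFin; apply: eq_bigr => n _.
  rewrite -prodEFin; apply: eq_bigr => j /andP[_ /eqP <-].
  exact: gumbel_g.
rewrite HS//; last by move=> n x; apply: prodr_ge0 => j _; exact: expR_ge0.
rewrite -sumrN expR_sum -prodEFin; apply: eq_bigr => n _.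
under [in RHS]eq_bigr do rewrite mulNr.
exact: integral_prod_gumbel_cdf.
Qed.

End nested_logit_cdf.

(** * The standard Gumbel law *)

Section eq_cdf.
Context {R : realType} {d d' : measure_display} {T : measurableType d}
  {T' : measurableType d'} {P : probability T R} {Q : probability T' R}.

(** One-dimensional case of [same_cdf_same_joint_law]. *)
Lemma eq_cdf_eq_law (X : {RV P >-> R}) (Y : {RV Q >-> R}) :
  (forall a, cdf X a = cdf Y a) ->
  forall A, measurable A -> P (X @^-1` A) = Q (Y @^-1` A).
Proof.
move=> XY A mA.
apply: (@same_cdf_same_joint_law R unit _ _ P _ _ Q (fun=> X) (fun=> Y) _ _ _
  [set x | A (x tt)]) => //; last by apply: sub_sigma_algebra; exists tt, A.
move=> a; have all_tt S (V : S -> R) :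
    [set w | forall j, V w <= a j] = V @^-1` `]-oo, a tt].
  by apply/seteqP; split => w /=; rewrite in_itv/= => H; first exact: (H tt); case.
by rewrite !all_tt; exact: XY.
Qed.

End eq_cdf.

Section gumbel.
Context {R : realType}.

Definition gumbel_cdf (z : R) : R := expR (- expR (- z)).

Let gumbel_cdf_nd : nondecreasing gumbel_cdf.
Proof. by move=> x y xy; rewrite ler_expR lerN2 ler_expR lerN2. Qed.

Let gumbel_cdf_rc : right_continuous gumbel_cdf.
Proof.
move=> x; apply: cvg_at_right_filter.
have cN y : {for y, continuous (-%R : R -> R)} by exact: opp_continuous.
apply: (@continuous_comp _ _ _ (fun z => - expR (- z)) expR); last exact: continuous_expR.
apply: (@continuous_comp _ _ _ (fun z => expR (- z)) -%R) => //.
apply: (@continuous_comp _ _ _ -%R expR) => //; exact: continuous_expR.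
Qed.

Let gumbel_cdf_Ny : gumbel_cdf @ -oo --> (0 : R).
Proof.
apply/cvgNy_compNP; rewrite /gumbel_cdf.
rewrite (_ : _ \o _ = (fun x => expR (- x)) \o expR); last first.
  by apply/funext => x /=; rewrite opprK.
apply: (cvg_comp expR (fun x => expR (- x)) _ (@cvgr_expR R)).
apply: (@ger_cvgy _ _ _ _ id); last exact: cvg_id.
by apply: nearW => x; rewrite (le_trans _ (expR_ge1Dx x))// lerDr.
Qed.

Let gumbel_cdf_y : gumbel_cdf @ +oo --> (1 : R).
Proof.
rewrite -[X in _ --> X]expR0 -[X in expR X]oppr0.
have NeN : - expR (- x) @[x --> +oo] --> - (0 : R) by apply: cvgN; exact: cvgr_expR.
exact: (cvg_comp (fun x : R => - expR (- x)) expR NeN (@continuous_expR R (- 0))).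
Qed.

HB.instance Definition _ :=
  isCumulative.Build R _ R gumbel_cdf gumbel_cdf_nd gumbel_cdf_rc.
HB.instance Definition _ :=
  isCumulativeBounded.Build R 0 1 gumbel_cdf gumbel_cdf_Ny gumbel_cdf_y.

(** The Lebesgue-Stieltjes measure of the distribution function; its image under
  the identity only changes the display of the sigma-algebra of the line. *)
Lemma gumbel_exists : exists mu : probability R R, standard_gumbel mu.
Proof.
have mid : measurable_fun [set: measurableTypeR R] (idfun : measurableTypeR R -> R).
  exact: measurable_id.
pose P := lebesgue_stieltjes_measure gumbel_cdf : probability (measurableTypeR R) R.
pose X := @mfun_Sub _ _ (measurableTypeR R) R idfun (mem_set mid).
exists (@distribution _ _ (measurableTypeR R) R R P X) => z.
exact: (cdf_lebesgue_stieltjes_id gumbel_cdf z).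
Qed.

End gumbel.

(** * Moments of the Gumbel law *)

Section square_integrability.
Context {R : realType} {d : measure_display} {T : measurableType d}
  {P : probability T R}.
Local Open Scope ereal_scope.

Lemma integrable_sqr_Lfun2 (X : {RV P >-> R}) :
  \int[P]_w ((X w ^+ 2)%R)%:E < +oo -> (X : T -> R) \in Lfun P 2%:E.
Proof.
move=> X2; rewrite inE; apply/andP; split; rewrite inE/=; first exact: measurable_funP.
rewrite /finite_norm unlock /= poweR_lty//.
by under eq_integral do rewrite powR_mulrn// real_normK ?num_real//.
Qed.

(** [X ^ 2] is at most the sum over [k] of [4 * (k + 1) ^ 2] on the event
  [2 * k - 1 < |X|]: the term [k] with [2 * k <= |X| < 2 * (k + 1)] suffices. The
  tail bound makes the integrals of these terms decay like [expR (- k)]. *)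
Lemma exp_tail_Lfun2 (X : {RV P >-> R}) (C : R) : (0 <= C)%R ->
  (forall t : R, P [set w | t < `|X w|]%R <= (C * expR (- t))%:E) ->
  (X : T -> R) \in Lfun P 2%:E.
Proof.
move=> C0 tail; apply: integrable_sqr_Lfun2.
pose t k : R := (2 * k%:R - 1)%R.
pose A k := [set w | t k < `|X w|]%R.
have mA k : measurable (A k).
  rewrite (_ : A k = (fun w => `|X w|%R) @^-1` `]t k, +oo[).
    rewrite -[X in measurable X]setTI.
    by apply: measurableT_comp => //; exact: measurable_itv.
  by apply/seteqP; split => w /=; rewrite /A /= in_itv/= andbT.
pose c k : R := (4 * k.+1%:R ^+ 2)%R.
have c0 k : (0 <= c k)%R by rewrite /c mulr_ge0// sqr_ge0.
pose h k w : \bar R := (c k * \1_(A k) w)%:E.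
have h0 k w : 0 <= h k w by rewrite lee_fin mulr_ge0.
have mh k : measurable_fun [set: T] (h k).
  by apply/measurable_EFinP; apply: measurable_funM => //; exact: measurable_indic.
have sqr_le w : ((X w ^+ 2)%R)%:E <= \sum_(k <oo) h k w.
  pose u := (`|X w| / 2)%R; pose k := Num.truncn u.
  have /andP[ku uk] : (k%:R <= u < k.+1%:R)%R by apply: truncn_itv; rewrite /u divr_ge0.
  apply: (@le_trans _ _ (\sum_(0 <= i < k.+1) h i w)); last exact: nneseries_lim_ge.
  rewrite big_nat_recr//=; apply: (@le_trans _ _ (h k w)); last first.
    by rewrite leeDr// sume_ge0.
  rewrite lee_fin /c indicE mem_set; last first.
    by rewrite /A /t /=; move: ku; rewrite /u ler_pdivlMr//; lra.
  rewrite mulr1 -real_normK ?num_real//.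
  have -> : (4 * k.+1%:R ^+ 2 = (2 * k.+1%:R) ^+ 2 :> R)%R by ring.
  rewrite ler_pXn2r ?nnegrE ?mulr_ge0//.
  by move: uk; rewrite /u ltr_pdivrMr//; lra.
(* each term of the series is at most [D / 2 ^ (k + 1)] *)
pose D : R := (16 * C * expR 2)%R.
have D0 : (0 <= D)%R by rewrite /D !mulr_ge0// expR_ge0.
apply: (@le_lt_trans _ _ D%:E); last exact: ltry.
apply: (@le_trans _ _ (\int[P]_w \sum_(k <oo) h k w)).
  apply: ge0_le_integral => //.
  - by move=> w _; rewrite lee_fin sqr_ge0.
  - by apply/measurable_EFinP; exact: measurable_funX.
  - by apply: ge0_emeasurable_sum.
rewrite integral_nneseries//.
apply: (le_trans _ (epsilon_trick0 xpredT D0)).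
apply: lee_nneseries => [k _ _|k _]; first exact: integral_ge0.
rewrite /h; under eq_integral do rewrite EFinM.
rewrite ge0_integralZl//; [|by apply/measurable_EFinP; exact: measurable_indic
  |by rewrite lee_fin].
rewrite integral_indic// setIT.
apply: (@le_trans _ _ ((c k)%:E * (C * expR (- t k))%:E)).
  by apply: lee_wpmul2l; [rewrite lee_fin|exact: tail].
rewrite -EFinM lee_fin /c /t /D.
have sq_le : (k.+1%:R ^+ 2 <= 2 * expR k.+1%:R :> R)%R.
  have := @expR_ge1Dxn R k.+1%:R 1 (ler0n _ _).
  by rewrite (_ : 2`! = 2)%N//; lra.
have half_le : (expR (- k%:R) <= ((2 ^ k)%:R)^-1 :> R)%R.
  rewrite expRN lef_pV2 ?posrE ?expR_gt0 ?ltr0n ?expn_gt0// -[k%:R]mulr1 expRM_natl natrX.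
  by rewrite lerXn2r ?nnegrE ?expR_ge0//; have := expR_ge1Dx (1:R); lra.
have -> : (- (2 * k%:R - 1) = - k.+1%:R + - k%:R + 2 :> R)%R by rewrite -natr1; lra.
rewrite 2!expRD.
have -> : (16 * C * expR 2 / (2 ^ k.+1)%:R = (8 * C * expR 2) * ((2 ^ k)%:R)^-1 :> R)%R.
  by rewrite expnS natrM invfM; field; rewrite pnatr_eq0 expn_eq0.
have -> : (4 * k.+1%:R ^+ 2 * (C * (expR (- k.+1%:R) * expR (- k%:R) * expR 2)) =
  (4 * C * expR 2) * ((k.+1%:R ^+ 2 * expR (- k.+1%:R)) * expR (- k%:R)) :> R)%R by ring.
have -> : (8 * C * expR 2 / (2 ^ k)%:R =
  (4 * C * expR 2) * (2 * ((2 ^ k)%:R)^-1) :> R)%R by ring.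
apply: ler_wpM2l; first by rewrite !mulr_ge0// expR_ge0.
apply: ler_pM => //.
by rewrite expRN ler_pdivrMr ?expR_gt0.
Qed.

End square_integrability.

Section gumbel_moments.
Context {R : realType} {d : measure_display} {T : measurableType d}
  {P : probability T R}.
Local Open Scope ereal_scope.

Lemma gumbel_Lfun2 (X : {RV P >-> R}) :
  standard_gumbel (distribution P X) -> (X : T -> R) \in Lfun P 2%:E.
Proof.
move=> gX; apply: (@exp_tail_Lfun2 _ _ _ _ _ 2) => // t.
have cdfE a : cdf X a = (expR (- expR (- a)))%:E by exact: gX.
apply: (@le_trans _ _ (ccdf X t + cdf X (- t)%R)).
  rewrite /ccdf /cdf /distribution /pushforward.

  apply: (le_trans _ (measureU2 _ _ _)); last 2 first.
  - exact: measurable_funPTI.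
  - exact: measurable_funPTI.
  apply: le_measure; rewrite ?inE.
  - rewrite (_ : [set w | _] = (fun w => `|X w|%R) @^-1` `]t, +oo[).
      rewrite -[X in measurable X]setTI.
      by apply: measurableT_comp => //; exact: measurable_itv.
    by apply/seteqP; split => w /=; rewrite in_itv/= andbT.
  - by apply: measurableU; exact: measurable_funPTI.
  - move=> w /=; rewrite !in_itv/= andbT; case: (ger0P (X w)) => _ tX; first by left.
    by right; lra.
rewrite ccdf_1_cdf !cdfE opprK -EFinB -EFinD lee_fin.
have := expR_ge1Dx (- expR (- t)).
have : (expR (- expR t) <= expR (- t))%R.
  by rewrite ler_expR lerN2 (le_trans _ (expR_ge1Dx t))// lerDr.
lra.
Qed.

(** If the variance vanished, Chebyshev's inequality would give probability [0] to
  the values at most [m - 1], with [m] the mean, whereas the Gumbel distribution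
  function is positive everywhere. *)
Lemma gumbel_variance_gt0 (X : {RV P >-> R}) :
  standard_gumbel (distribution P X) -> 0 < variance P X.
Proof.
move=> gX; rewrite lt_neqAle variance_ge0 andbT; apply/eqP => V0.
pose m := fine 'E_P[X].
have := @chebyshev _ _ _ P X 1 ltr01; rewrite -V0 mule0 => tail0.
have : cdf X (m - 1)%R <= 0.
  rewrite /cdf /distribution /pushforward.
  apply: (le_trans _ tail0); apply: le_measure; rewrite ?inE.
  - exact: measurable_funPTI.
  - rewrite (_ : [set w | _] = (fun w => `|X w - m|%R) @^-1` `[1%R, +oo[).
      rewrite -[X in measurable X]setTI.
      have mXm : measurable_fun [set: T] (fun w => `|X w - m|%R).
        by apply: measurableT_comp => //; apply: measurable_funB.
      by apply: mXm => //; exact: measurable_itv.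
    by apply/seteqP; split => w /=; rewrite in_itv/= andbT.
  - move=> w /=; rewrite in_itv/= => Xm.
    by rewrite distrC (le_trans _ (ler_norm _))//; rewrite -/m; lra.
by rewrite [X in X <= _](gX (m - 1)%R) lee_fin leNgt expR_gt0.
Qed.

End gumbel_moments.

(** * Independent variables are uncorrelated *)

Section uncorrelated.
Context {R : realType} {d : measure_display} {T : measurableType d}
  {P : probability T R}.
Local Open Scope ereal_scope.

(** The law of the pair is the product of the marginal laws, so Fubini's theorem
  factors the expectation of the product. Square integrability supplies the
  integrability of the product. *)
Lemma independent_covariance0 (U V : {RV P >-> R}) :
  (forall A B, measurable A -> measurable B ->
     P (U @^-1` A `&` V @^-1` B) = P (U @^-1` A) * P (V @^-1` B)) ->
  (U : T -> R) \in Lfun P 2%:E -> (V : T -> R) \in Lfun P 2%:E ->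
  covariance P U V = 0.
Proof.
move=> indep U2 V2.
have Pfin : P setT \is a fin_num by exact: fin_num_measure.
have U1 := Lfun_subset12 Pfin U2.
have V1 := Lfun_subset12 Pfin V2.
have UV1 := Lfun2_mul_Lfun1 U2 V2.
pose W w := (U w, V w).
have mW : measurable_fun [set: T] W by exact: measurable_fun_pair.
pose W' := mfun_Sub (mem_set mW).
pose joint : probability (R * R)%type R := distribution P U \x distribution P V.
have law A : measurable A -> P (W @^-1` A) = joint (id @^-1` A).
  move=> mA; apply/esym.
  apply: (@product_measure_unique _ _ _ _ _ (distribution P U) (distribution P V)
    (distribution P W') _ A mA).
  by move=> B C mB mC; rewrite /distribution /pushforward -indep.
have mprod : measurable_fun [set: R * R] (fun x => (x.1 * x.2)%:E).
  apply/measurable_EFinP; apply: measurable_funM.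
    exact: measurable_fst.
  exact: measurable_snd.
have joint_int : joint.-integrable [set: R * R] (fun x => (x.1 * x.2)%:E).
  apply/integrableP; split => //.
  have mabs : measurable_fun [set: R * R] (fun x => `|(x.1 * x.2)%:E|).
    exact: measurableT_comp.
  have <- := eq_law_integral mW (@measurable_id _ _ setT) law _ mabs.
  by move/Lfun1_integrable/integrableP : UV1 => [_].
have -> : covariance P U V = 'E_P[U * V] - 'E_P[U] * 'E_P[V] by exact: covarianceE.
suff -> : 'E_P[U * V] = 'E_P[U] * 'E_P[V].
  by rewrite subee// fin_numM ?expectation_fin_num.
have Uint := U1; have Vint := V1.
move/Lfun1_integrable in Uint; move/Lfun1_integrable in Vint.
rewrite unlock.
have := eq_law_integral mW (@measurable_id _ _ setT) law _ mprod.
rewrite /W /= => ->.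
rewrite -(@integral12_prod_meas1 _ _ _ _ _ _ _ _ joint_int) /fubini_F /=.
rewrite -[X in X * _](@integral_distribution _ _ _ _ _ P U EFin)//.
rewrite -[X in _ * X](@integral_distribution _ _ _ _ _ P V EFin)//.
have Vint' : (distribution P V).-integrable [set: R] EFin.
  by apply: integrable_pushforward => //; exact: measurable_funP.
have Uint' : (distribution P U).-integrable [set: R] EFin.
  by apply: integrable_pushforward => //; exact: measurable_funP.
under eq_integral => x _.
  under eq_integral do rewrite EFinM.
  rewrite integralZl//.
  over.
rewrite -(fineK (integrable_fin_num _ Vint'))//.
by rewrite integralZr.
Qed.

End uncorrelated.

Section mutual_independence.
Context {R : realType} {I : finType} {d : measure_display}
  {T : measurableType d} {Q : probability T R} {X : I -> {RV Q >-> R}}.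
Hypothesis indep : mutually_independent X.
Local Open Scope ereal_scope.

(** [U] and [V] are linked to the family by pointwise equations so that the lemma
  applies both to the variables themselves and to their logarithms. *)
Lemma mutually_independent_covariance0 (i k : I) (f h : R -> R)
    (U V : {RV Q >-> R}) :
  i != k -> measurable_fun [set: R] f -> measurable_fun [set: R] h ->
  (forall w, U w = f (X i w)) -> (forall w, V w = h (X k w)) ->
  (U : T -> R) \in Lfun Q 2%:E -> (V : T -> R) \in Lfun Q 2%:E ->
  covariance Q U V = 0.
Proof.
move=> ik mf mh Uf Vh; apply: independent_covariance0 => A B mA mB.
have preE (W : T -> R) (p : R -> R) l C : (forall w, W w = p (X l w)) ->
    W @^-1` C = X l @^-1` (p @^-1` C).
  by move=> Wp; apply/seteqP; split => w /=; rewrite Wp.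
rewrite (preE U f i)// (preE V h k)//.
have mfA : measurable (f @^-1` A) by rewrite -[X in measurable X]setTI; exact: mf.
have mhB : measurable (h @^-1` B) by rewrite -[X in measurable X]setTI; exact: mh.
pose E l := if l == i then f @^-1` A else h @^-1` B.
have mE l : measurable (E l) by rewrite /E; case: ifP.
have := indep [set i; k]%SET E mE.
rewrite big_setU1 ?inE//= big_set1 /E eqxx eq_sym (negbTE ik) => <-.
congr (Q _); apply/seteqP; split => w /=.
  move=> [Uw Vw] l; rewrite !finset.inE => /orP[]/eqP ->; rewrite ?eqxx//.
  by rewrite eq_sym (negbTE ik).
move=> H; split; first by have := H i; rewrite !finset.inE eqxx; exact.
by have := H k; rewrite !finset.inE eqxx orbT eq_sym (negbTE ik); exact.
Qed.

End mutual_independence.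

(** * Marginals and covariances of the nested logit law *)

Section nested_logit_moments.
Context {R : realType} {J N : finType} {nu : J -> N} {lam : N -> R}.
Hypothesis lam_gt0 : forall n, 0 < lam n.
Context {d : measure_display} {T : measurableType d} {Q : probability T R}
  {g : J -> {RV Q >-> R}} {Z : N -> {RV Q >-> R}} {Y : J -> {RV Q >-> R}}.
Hypotheses (gumbel_g : forall j, standard_gumbel (distribution Q (g j)))
  (stable_Z : forall n, positive_stable (lam n) (distribution Q (Z n)))
  (indep : mutually_independent
     (fun i : J + N => match i with inl j => g j | inr n => Z n end))
  (YE : forall j w, Y j w = lam (nu j) * (g j w + ln (Z (nu j) w))).

(** A single alternative contributes [(expR (- a / lam n)) `^ lam n], which is
  [expR (- a)]. *)
Lemma nested_logit_gumbel (j : J) : standard_gumbel (distribution Q (Y j)).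
Proof.
move=> a.
have := nested_logit_cdf (nu := nu) lam_gt0 gumbel_g stable_Z indep
  (finset.set1 j) (fun=> a).
rewrite (_ : [set w | _] = Y j @^-1` `]-oo, a]); last first.
  apply/seteqP; split => w /=; rewrite in_itv/= YE.
    by apply; rewrite finset.inE.
  by move=> Yw i; rewrite finset.inE => /eqP ->.
move=> cdfY; apply: (etrans cdfY); congr (expR (- _))%:E.
rewrite (bigD1 (nu j))//= [X in _ + X]big1 ?addr0 => [|n nj].
  rewrite (big_pred1 j) => [|i]; last first.
    by rewrite finset.inE /=; case: (i =P j) => [->|]; rewrite ?eqxx.
  by rewrite -expRM divfK ?gt_eqF.
rewrite big_pred0 ?powR0 ?gt_eqF// => i.
by rewrite finset.inE; apply/andP => -[/eqP -> /eqP jn]; rewrite jn eqxx in nj.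
Qed.

Let mlnZ n : measurable_fun [set: T] (fun w => ln (Z n w)).
Proof. by apply: measurableT_comp; [exact: measurable_ln|exact: measurable_funP]. Qed.

Let lnZ n : {RV Q >-> R} := mfun_Sub (mem_set (mlnZ n)).

Let YZ j : (Y j : T -> R) = lam (nu j) \o* (g j \+ lnZ (nu j)).
Proof. by apply/funext => w; rewrite YE mulrC. Qed.

Let g2 j : (g j : T -> R) \in Lfun Q 2%:E.
Proof. exact: gumbel_Lfun2. Qed.

Let Y2 j : (Y j : T -> R) \in Lfun Q 2%:E.
Proof. exact: gumbel_Lfun2 (nested_logit_gumbel j). Qed.

(* both [Y j] and [g j] are Gumbel, and [ln (Z n)] is [Y j / lam n - g j] *)
Let lnZ2 j : (lnZ (nu j) : T -> R) \in Lfun Q 2%:E.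
Proof.
rewrite (_ : (lnZ (nu j) : T -> R) = (((lam (nu j))^-1 \o* Y j) \- g j)).
  by rewrite rpredB ?lee1n//= ?Lfun_scale ?ler1n.
apply/funext => w /=; rewrite YE mulrC mulKf ?gt_eqF//.
by rewrite addrC addKr.
Qed.

Let Pfin : Q [set: T] \is a fin_num.
Proof. exact: fin_num_measure. Qed.

Local Open Scope ereal_scope.

Let cov_g_lnZ i j : covariance Q (g i) (lnZ (nu j)) = 0.
Proof.
have := mutually_independent_covariance0 indep (inl i) (inr (nu j)) idfun
  (@ln R) (g i) (lnZ (nu j)).
by apply => //; exact: measurable_id.
Qed.

Let sum2 j : (g j \+ lnZ (nu j))%R \in Lfun Q 2%:E.
Proof. by rewrite rpredD ?lee1n. Qed.

Lemma nested_logit_variance j :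
  variance Q (Y j) =
  ((lam (nu j)) ^+ 2)%:E * (variance Q (g j) + variance Q (@ln R \o Z (nu j))).
Proof.
by rewrite YZ varianceZ// varianceD// cov_g_lnZ mule0 adde0.
Qed.

(** Of the four covariances in the expansion only that of the two logarithms
  survives; it is a variance when both alternatives lie in the same nest. *)
Lemma nested_logit_covariance j j' : j != j' ->
  covariance Q (Y j) (Y j') =
  (lam (nu j) * lam (nu j'))%:E *
    covariance Q (@ln R \o Z (nu j)) (@ln R \o Z (nu j')).
Proof.
move=> jj'; rewrite !YZ.
have S1 i := Lfun_subset12 Pfin (sum2 i).
have SS1 := Lfun2_mul_Lfun1 (sum2 j) (sum2 j').
have Z2 : (lam (nu j') \o* (g j' \+ lnZ (nu j')))%R \in Lfun Q 2%:E.
  by apply: Lfun_scale => //; rewrite ler1n.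
rewrite covarianceZl//; [|exact: Lfun_subset12|exact: Lfun2_mul_Lfun1].
rewrite covarianceZr// muleA -EFinM; congr (_ * _).
rewrite covarianceDl// !covarianceDr//.
rewrite (mutually_independent_covariance0 indep (inl j) (inl j') idfun idfun
  (g j) (g j'))//; [|exact: measurable_id|exact: measurable_id].
by rewrite cov_g_lnZ covarianceC cov_g_lnZ !add0e.
Qed.

Lemma stable_log_covariance0 j j' : nu j != nu j' ->
  covariance Q (@ln R \o Z (nu j)) (@ln R \o Z (nu j')) = 0.
Proof.
move=> njj'.
have := mutually_independent_covariance0 indep (inr (nu j)) (inr (nu j'))
  (@ln R) (@ln R) (lnZ (nu j)) (lnZ (nu j')).
by apply => //; exact: measurable_ln.
Qed.

End nested_logit_moments.

(** * Representations of the nested logit law *)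

Section representations.
Context {R : realType} {J N : finType} {nu : J -> N} {lam : N -> R}.
Hypothesis lam_gt0 : forall n, 0 < lam n.

Let nest (n : N) : {set J} := [set j | nu j == n]%SET.

Lemma measurable_representation {d} {T : measurableType d}
    {Q : probability T R} {g : J -> {RV Q >-> R}} {Z : N -> {RV Q >-> R}}
    {Y : J -> T -> R} :
  nested_logit_representation nest lam g Z Y ->
  forall j, measurable_fun [set: T] (Y j).
Proof.
move=> [_ _ _ YE] j.
rewrite (_ : Y j = fun w => lam (nu j) * (g j w + ln (Z (nu j) w))).
  apply: measurable_funM => //; apply: measurable_funD => //.
  by apply: measurableT_comp; [exact: measurable_ln|exact: measurable_funP].
by apply/funext => w; apply: YE; rewrite finset.inE.
Qed.

Lemma representation_same_joint_law {d} {T : measurableType d}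
    {P : probability T R} {eps : J -> {RV P >-> R}} {d'} {T' : measurableType d'}
    {Q : probability T' R} {g : J -> {RV Q >-> R}} {Z : N -> {RV Q >-> R}}
    {Y : J -> T' -> R} :
  (forall a : J -> R,
     P [set w | forall j, eps j w <= a j] =
     (expR (- \sum_(n : N)
                (\sum_(j in nest n) expR (- a j / lam n)) `^ lam n))%:E) ->
  nested_logit_representation nest lam g Z Y -> same_joint_law P eps Q Y.
Proof.
move=> eps_cdf rep; apply: same_cdf_same_joint_law => [//||a].
  exact: measurable_representation rep.
have [gumbel_g stable_Z indep YE] := rep.
rewrite eps_cdf.
have := nested_logit_cdf (nu := nu) lam_gt0 gumbel_g stable_Z indep finset.setT a.
rewrite (_ : [set w | _] = [set w | forall j, Y j w <= a j]); last first.
  apply/seteqP; split => w H j => [|_].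
    by rewrite (YE (nu j)) ?finset.inE//; apply: H; rewrite finset.inE.
  by rewrite -(YE (nu j)) ?finset.inE//; exact: H.
move=> ->; congr (expR (- _))%:E; apply: eq_bigr => n _; congr (_ `^ _).
by apply: eq_bigl => j; rewrite !finset.inE.
Qed.

Lemma representation_exists :
  (forall n, exists mu : probability R R, positive_stable (lam n) mu) ->
  exists (d' : measure_display) (T' : measurableType d')
          (Q : probability T' R)
          (g : J -> {RV Q >-> R}) (Z : N -> {RV Q >-> R}) (Y : J -> T' -> R),
     nested_logit_representation nest lam g Z Y.
Proof.
move=> /choice[stable stableP].
have [gumbel gumbelP] := @gumbel_exists R.
have [d [T [Q [X [XD Xindep]]]]] := exists_mutually_independent
  (fun i : J + N => match i with inl j => gumbel | inr n => stable n end).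
exists d, T, Q, (fun j => X (inl j)), (fun n => X (inr n)).
exists (fun j w => lam (nu j) * (X (inl j) w + ln (X (inr (nu j)) w))); split.
- by move=> j z; exact: (etrans (XD (inl j) _ (measurable_itv _)) (gumbelP z)).
- move=> n; have [neg laplace] := stableP n; split.
    exact: (etrans (XD (inr n) _ (measurable_itv _)) neg).
  move=> t t0; rewrite -laplace//; apply: eq_measure_integral => A mA _.
  exact: (XD (inr n)).
- rewrite (_ : (fun i : J + N => _) = X)//.
  by apply/funext; case.
- by move=> n j; rewrite finset.inE => /eqP <-.
Qed.

End representations.

(** Nests are the fibres of the map sending an alternative to its nest; in this
  form sums over a nest are sums over a fibre, as partitioned sums require. *)
Lemma nest_function {J N : finType} (nest : N -> {set J}) :
  (forall m n, m != n -> nest m :&: nest n = finset.set0) ->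
  (forall j, exists n, j \in nest n) ->
  exists nu : J -> N, nest = (fun n => [set j | nu j == n]%SET).
Proof.
move=> disj /choice[nu nuP]; exists nu; apply/funext => n; apply/setP => j.
rewrite finset.inE; apply/idP/eqP => [jn|<-//].
apply: contrapT => /eqP /disj /setP /(_ j).
by rewrite !finset.inE jn nuP.
Qed.

Theorem proposition1 (R : realType)
  (stable_exists : forall l : R, 0 < l <= 1 ->
     exists mu : probability R R, positive_stable l mu)
  (N J : finType) (nest : N -> {set J}) (lam : N -> R)
  (N_nonempty : (0 < #|N|)%N)
  (nest_nonempty : forall n, (0 < #|nest n|)%N)
  (nest_disjoint : forall m n, m != n -> nest m :&: nest n = finset.set0)
  (nest_cover : forall j, exists n, j \in nest n)
  (lam_range : forall n, 0 < lam n <= 1)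
  (d : measure_display) (T : measurableType d) (P : probability T R)
  (eps : J -> {RV P >-> R})
  (eps_cdf : forall a : J -> R,
     P [set w | forall j, eps j w <= a j] =
     (expR (- \sum_(n : N)
                (\sum_(j in nest n) expR (- a j / lam n)) `^ lam n))%:E) :
  (exists (d' : measure_display) (T' : measurableType d')
          (Q : probability T' R)
          (g : J -> {RV Q >-> R}) (Z : N -> {RV Q >-> R}) (Y : J -> T' -> R),
     nested_logit_representation nest lam g Z Y /\ same_joint_law P eps Q Y) /\
  (forall (d' : measure_display) (T' : measurableType d')
          (Q : probability T' R)
          (g : J -> {RV Q >-> R}) (Z : N -> {RV Q >-> R}) (Y : J -> T' -> R),
     nested_logit_representation nest lam g Z Y -> same_joint_law P eps Q Y) /\
  (forall j, (eps j : T -> R) \in Lfun P 2%:E /\ (0 < variance P (eps j))%E) /\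
  (forall n n' j j', j \in nest n -> j' \in nest n' -> j != j' ->
     correlation P (eps j) (eps j') = if n == n' then 1 - lam n ^+ 2 else 0).
Proof.
have [nu nestE] := nest_function nest nest_disjoint nest_cover.
subst nest.
have lam_gt0 n : 0 < lam n by have /andP[] := lam_range n.
have [d0 [T0 [Q [g [Z [Y rep]]]]]] := representation_exists (nu := nu)
  (fun n => stable_exists _ (lam_range n)).
have law := representation_same_joint_law lam_gt0 eps_cdf rep.
have mY := measurable_representation rep.
pose Y' j : {RV Q >-> R} := mfun_Sub (mem_set (mY j)).
have [gumbel_g stable_Z indep YE] := rep.
have Y'E j w : Y' j w = lam (nu j) * (g j w + ln (Z (nu j) w)).
  by apply: YE; rewrite finset.inE.
have gumbel_Y := nested_logit_gumbel lam_gt0 gumbel_g stable_Z indep Y'E.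
have gumbel_eps j : standard_gumbel (distribution P (eps j)).
  move=> z; rewrite -(gumbel_Y j z).
  apply: (law [set x | `]-oo, z]%classic (x j)]).
  by apply: sub_sigma_algebra; exists j, `]-oo, z]%classic.
have eps_moments j : (eps j : T -> R) \in Lfun P 2%:E /\ (0 < variance P (eps j))%E.
  by split; [exact: gumbel_Lfun2|exact: gumbel_variance_gt0].
split; first by exists d0, T0, Q, g, Z, Y.
split; first by move=> d' T' Q' g' Z' Y'' rep'; exact: representation_same_joint_law rep'.
split; first exact: eps_moments.
move=> n n' j j'; rewrite !finset.inE => /eqP <- /eqP <- jj'.
(* the common variance of all standard Gumbel variables *)
pose v := fine (variance Q (g j)).
have g_fin : variance Q (g j) = v%:E.
  by rewrite fineK// variance_fin_num// gumbel_Lfun2.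
have var_gumbel d1 (T1 : measurableType d1) (P1 : probability T1 R)
    (X : {RV P1 >-> R}) : standard_gumbel (distribution P1 X) ->
    variance P1 X = v%:E.
  move=> gX; rewrite -g_fin.
  apply: (@eq_law_variance _ _ _ _ _ _ _ _ _ X (g j) _ _ _ idfun) => //.
    apply: eq_cdf_eq_law => a; exact: (etrans (gX a) (esym (gumbel_g j a))).
  exact: measurable_id.
have v_gt0 : 0 < v by rewrite -lte_fin -g_fin gumbel_variance_gt0.
have covE : covariance P (eps j) (eps j') = covariance Q (Y' j) (Y' j').
  pose RJ := g_sigma_algebraType (coordinate_cylinders R J).
  apply: (@eq_law_covariance _ _ _ _ _ _ RJ _ _ (fun w i => eps i w)
    (fun w i => Y i w) _ _ law (fun x => x j) (fun x => x j')).
  - exact: measurable_to_function_space.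
  - exact: measurable_to_function_space.
  - exact: measurable_coordinate.
  - exact: measurable_coordinate.
rewrite /correlation !var_gumbel// -expr2 sqr_sqrtr ?ltW//= covE.
rewrite (nested_logit_covariance lam_gt0 gumbel_g stable_Z indep Y'E)//.
case: eqVneq => [nn'|nn']; last first.
  by rewrite (stable_log_covariance0 lam_gt0 gumbel_g stable_Z indep Y'E)// mule0 mul0r.
rewrite -nn' -expr2.
have := nested_logit_variance lam_gt0 gumbel_g stable_Z indep Y'E j.
rewrite var_gumbel// g_fin -/(covariance Q _ _) => /esym.
rewrite -[covariance _ _ _]/(variance Q (@ln R \o Z (nu j))).
case: (variance Q (@ln R \o Z (nu j))) => [x| |] /=.
- move=> [vx]; have -> : lam (nu j) ^+ 2 * x = v * (1 - lam (nu j) ^+ 2).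
    by rewrite mulrBr mulr1 -[X in X - _]vx; ring.
  by rewrite mulrC mulKf ?gt_eqF.
(* an infinite variance of [ln (Z n)] would make that of the Gumbel [Y j] infinite *)
- by rewrite addey// gt0_muley ?lte_fin ?exprn_gt0.
- by rewrite addeNy gt0_muleNy ?lte_fin ?exprn_gt0.
Qed.
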